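(* Let $(a_n)_{n=1}^\infty$ be a strictly decreasing sequence of positive numbers with $a_n\to 0$ as $n\to\infty$. If \[ \lim_{n\to\infty}\frac{a_{n+1}}{a_n}=1, \] then there exists a compact set $E\subset\mathbb{R}$ with positive Lebesgue measure such that $(a_n)_{n=1}^\infty$ cannot be bi-Lipschitz embedded into $E$.
   Context: A map $f:\mathbb{R}\to\mathbb{R}$ is bi-Lipschitz if there exists a constant $L>1$ such that $L^{-1}|x-y|\le |f(x)-f(y)|\le L|x-y|$ for all $x,y\in\mathbb{R}$. A set $A\subset\mathbb{R}$ can be bi-Lipschitz embedded into a set $E\subset\mathbb{R}$ if there is a bi-Lipschitz map $f:\mathbb{R}\to\mathbb{R}$ with $f(A)\subset E$. A sequence $(a_n)_{n=1}^\infty$ is identified with the set $\{a_n: n\ge 1\}$. *)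

(* Defs.v *)
From HB Require Import structures.
From mathcomp Require Import all_boot all_order all_algebra.
From mathcomp Require Import all_classical all_reals all_analysis.
Set Implicit Arguments.
Unset Strict Implicit.
Unset Printing Implicit Defensive.
Import Order.TTheory GRing.Theory Num.Theory.
Import numFieldNormedType.Exports.
Local Open Scope classical_set_scope.
Local Open Scope ring_scope.

Definition bilipschitz (R : realType) (f : R -> R) : Prop :=
  exists2 L : R, 1 < L &
    forall x y : R,
      L^-1 * `|x - y| <= `|f x - f y| /\ `|f x - f y| <= L * `|x - y|.

(* The embedding is a map of the whole line, not merely of A. *)
Definition bilipschitz_embeds (R : realType) (A E : set R) : Prop :=
  exists2 f : R -> R, bilipschitz f & f @` A `<=` E.

(* Main.v *)
(* Let E be [0, 1] minus periodic "fences" U_k, where U_k is the union of the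
   balls of radius eta_k / m_k around the points j / m_k (j in Z). As U_k takes
   up a proportion of order eta_k of [0, 1], summability of eta_k leaves E with
   positive measure, however fast m_k grows. A bi-Lipschitz image b_n = f (a_n)
   converges to p = f 0, and its step at distance of order 1 / m_k from p is
   o(1 / m_k) because a_{n+1} / a_n -> 1. Hence, if m_k is chosen large in terms
   of eta_k and of the constants L <= k + 1, then b_n cannot jump over the first
   post of U_k between p and some b_M, and so leaves E. *)

Require Import Defs.
From HB Require Import structures.
From mathcomp Require Import all_boot all_order all_algebra.
From mathcomp Require Import all_classical all_reals all_analysis.
From mathcomp Require Import measurable_realfun ring lra.
Set Implicit Arguments.
Unset Strict Implicit.
Unset Printing Implicit Defensive.
Import Order.TTheory GRing.Theory Num.Theory.
Import numFieldNormedType.Exports.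
Local Open Scope classical_set_scope.
Local Open Scope ring_scope.

Definition fence (R : realType) (m : nat) (eta : R) : set R :=
  \bigcup_(j : int) ball (j%:~R / m%:R : R) (eta / m%:R).

Lemma fence_opp (R : realType) (m : nat) (eta x : R) :
  fence m eta (- x) -> fence m eta x.
Proof.
move=> [j _]; rewrite /ball /= => jx; exists (- j) => //; rewrite /ball /=.
by rewrite -normrN rmorphN /= mulNr opprD !opprK -[x]opprK.
Qed.

Lemma open_fence (R : realType) (m : nat) (eta : R) : open (fence m eta).
Proof. by apply: bigcup_open => j _; exact: ball_open. Qed.

Lemma measurable_fence (R : realType) (m : nat) (eta : R) :
  measurable (fence m eta).
Proof. by apply: open_measurable; exact: open_fence. Qed.

(** Since [eta <= 1], only the balls centred at j / m with 0 <= j <= m can meet [0, 1]. These m + 1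
    balls have length 2 eta / m each, and m + 1 <= 2 m. *)
Lemma fence_measure (R : realType) (m : nat) (eta : R) :
  (0 < m)%N -> 0 < eta -> eta <= 1 ->
  (lebesgue_measure (`[0%R, 1%R] `&` fence m eta) <= (4 * eta)%:E)%E.
Proof.
move=> m0 eta0 eta1.
have m0R : 0 < m%:R :> R by rewrite ltr0n.
pose F (j : nat) : set R := ball (j%:R / m%:R : R) (eta / m%:R).
have FE j : lebesgue_measure (F j) = ((eta / m%:R) *+ 2)%:E.
  by rewrite lebesgue_measure_ball// divr_ge0// ltW.
have sub : `[0, 1] `&` fence m eta `<=` \big[setU/set0]_(j < m.+1) F j.
  move=> x [/=]; rewrite in_itv/= => /andP[x0 x1] [j _].
  rewrite /ball /= => jx.
  have jxm : `|j%:~R - x * m%:R| < 1.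
    apply: lt_le_trans eta1; rewrite ltr_pdivlMr// in jx.
    rewrite -[X in _ * X](gtr0_norm m0R) -normrM mulrBl divfK ?gt_eqF// in jx.
  move: jxm; rewrite ltr_norml => /andP[jx1 jx2].
  have xm0 : 0 <= x * m%:R by rewrite mulr_ge0// ltW.
  have xm1 : x * m%:R <= m%:R by rewrite ler_piMl// ltW.
  have j0 : 0 <= j.
    by rewrite -ltzD1 -(ltr_int R) intrD /=; lra.
  have jm : j < m.+1%:Z.
    by rewrite -(ltr_int R) -pmulrn -natr1; lra.
  case: j j0 jm jx {jx1 jx2} => // n _ nm jx.
  by rewrite -bigcup_mkord; exists n.
apply: (le_trans (content_subadditive (@lebesgue_measure R) _ _ sub)).
- by move=> j _; exact: measurable_ball.
- by apply: measurableI => //; exact: measurable_fence.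
rewrite (eq_bigr (fun=> ((eta / m%:R) *+ 2)%:E)); last by move=> j _; exact: FE.
rewrite sumEFin lee_fin sumr_const card_ord.
rewrite -[_ *+ 2]mulr_natr -[_ *+ m.+1]mulr_natr -natr1.
have m1 : 1 <= m%:R :> R by rewrite ler1n.
have e0 : 0 < eta / m%:R by rewrite divr_gt0.
have etaE : eta / m%:R * m%:R = eta by rewrite divfK// gt_eqF.
nra.
Qed.

(** Let c be the first post above p. As b starts above c at [M] and tends to p < c, some step from
    [b i] to [b i.+1] crosses c. There [b i.+1] is within 1 / m of p, so [fine] makes the step
    shorter than eta / m, and [b i] lies in the ball around c. *)
Lemma fence_crossing (R : realType) (a b : nat -> R) (p L eta : R) (m M : nat) :
  (0 < m)%N -> 0 < L -> 0 < eta ->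
  a n @[n --> \oo] --> (0 : R) ->
  (forall n, a n <= L * `|b n - p|) ->
  (forall n, `|b n - p| <= L * a n) ->
  (forall n, `|b n - b n.+1| <= L * (a n - a n.+1)) ->
  (forall n, (M <= n)%N -> (a n - a n.+1) * L ^+ 2 <= a n.+1) ->
  (forall n, a n.+1 <= L / m%:R -> (a n - a n.+1) * L ^+ 2 < eta * a n.+1) ->
  p + m%:R^-1 < b M ->
  exists n, fence m eta (b n).
Proof.
move=> m0 L0 eta0 a0 lo up gap small fine pM.
have m0R : 0 < m%:R :> R by rewrite ltr0n.
have r0 : 0 < m%:R^-1 :> R by rewrite invr_gt0.
set r : R := m%:R^-1 in r0 pM fine *.
(* Floor plus one, not the ceiling: c must exceed p strictly even if p is itself a post. *)
pose j := Num.floor (p * m%:R) + 1.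
have /andP[j1 j2] := floor_itv (p * m%:R).
pose c : R := j%:~R / m%:R.
have pc : p < c by rewrite ltr_pdivlMr.
have cr : c <= p + r.
  rewrite ler_pdivrMr// mulrDl mulVf ?gt_eqF// /j rmorphD /=.
  by rewrite lerD2r.
have [n Mn bc] : exists2 n, (M <= n)%N & b n <= c.
  have e0 : 0 < (c - p) / L by rewrite divr_gt0// subr_gt0.
  have /cvgrPdist_lt/(_ _ e0)[N _ HN] := a0.
  exists (maxn M N); first exact: leq_maxl.
  have := HN (maxn M N) (leq_maxr _ _).
  rewrite /= sub0r normrN ltr_pdivlMr// => h.
  have := up (maxn M N); have := ler_norm (b (maxn M N) - p).
  move: h; have := ler_norm (a (maxn M N)); nra.
have [i [Mi ci ci1]] : exists i, [/\ (M <= i)%N, c < b i & b i.+1 <= c].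
  have cM : c < b M by lra.
  elim: n Mn bc => [|n IH] Mn bc.
    by move: Mn; rewrite leqn0 => /eqP M0; rewrite M0 in cM; lra.
  case: (ltnP n M) => nM.
    have nE : n.+1 = M by apply/eqP; rewrite eqn_leq Mn nM.
    by rewrite nE in bc; lra.
  case: (leP (b n) c) => bn; first exact: IH.
  by exists n.
exists i; exists j => //; rewrite /ball /= -/c.
rewrite distrC gtr0_norm ?subr_gt0//.
have d := le_trans (ler_norm _) (gap i).
(* If b jumped below p, the step would exceed the distance from p to b i.+1,
   which [small] forbids. *)
have aLr : a i.+1 <= L * r.
  have := lo i.+1; have := small _ Mi.
  case: (leP p (b i.+1)) => pb.
    by rewrite ger0_norm ?subr_ge0//; nra.
  rewrite ltr0_norm ?subr_lt0// opprB expr2; nra.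
have := fine _ aLr; rewrite expr2 => f.
have : L * (a i - a i.+1) < eta * r.
  rewrite -(ltr_pM2r L0); nra.
rewrite -/r; lra.
Qed.

Lemma relative_gap_small (R : realType) (a : nat -> R) (Q eta : R) :
  (forall n, 0 < a n) -> a n.+1 / a n @[n --> \oo] --> (1 : R) ->
  0 <= Q -> 0 < eta ->
  exists N : nat, forall n, (N <= n)%N -> (a n - a n.+1) * Q < eta * a n.+1.
Proof.
move=> pos ratio Q0 eta0.
(* The bound (a n - a n.+1) (Q + eta) < eta * a n rearranges to the claim. *)
have c0 : 0 < eta / (Q + eta) by rewrite divr_gt0//; lra.
have /cvgrPdist_lt/(_ _ c0)[N _ HN] := ratio.
exists N => n /HN /=.
move/(le_lt_trans (ler_norm _)).
rewrite ltr_pdivlMr; last lra.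
have an := pos n.
rewrite -(ltr_pM2r an) mulrAC mulrBl mul1r divfK ?gt_eqF//; nra.
Qed.

(** With N the threshold of [relative_gap_small], take m so large that K / m < a N; by monotonicity,
    [a n.+1 <= K / m] then forces n >= N. *)
Lemma fence_mesh (R : realType) (a : nat -> R) (K : nat) (Q eta : R) :
  decreasing_seq a -> (forall n, 0 < a n) ->
  a n.+1 / a n @[n --> \oo] --> (1 : R) -> 0 <= Q -> 0 < eta ->
  exists m : nat, (K < m)%N /\
    forall n, a n.+1 <= K%:R / m%:R -> (a n - a n.+1) * Q < eta * a n.+1.
Proof.
move=> dec pos ratio Q0 eta0.
have [N HN] := relative_gap_small pos ratio Q0 eta0.
pose m := maxn K.+1 (Num.truncn (K%:R / a N)).+1.
exists m; split; first exact: leq_maxl.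
move=> n an; apply: HN; rewrite leqNgt; apply/negP => nN.
have aNn : a N <= a n.+1 by rewrite dec.
have m0 : 0 < m%:R :> R by rewrite ltr0n /m leq_max.
have : K%:R / m%:R < a N.
  rewrite ltr_pdivrMr// mulrC -ltr_pdivrMr//.
  apply: lt_le_trans (truncnS_gt _) _.
  by rewrite ler_nat leq_maxr.
lra.
Qed.

Theorem theorem1p2 (R : realType) (a : nat -> R)
    (a_decr : decreasing_seq a)
    (a_pos : forall n : nat, 0 < a n)
    (a_cvg0 : a n @[n --> \oo] --> (0 : R))
    (a_ratio : a n.+1 / a n @[n --> \oo] --> (1 : R)) :
  exists E : set R,
    [/\ compact E,
        (0 < lebesgue_measure E)%E &
        ~ bilipschitz_embeds (range a) E].
Proof.
(* Chosen so that the bounds 4 eta_k of [fence_measure] sum to 1/2. *)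
pose eta k : R := 8^-1 / (2 ^ k.+1)%:R.
have eta0 k : 0 < eta k by rewrite divr_gt0// ltr0n expn_gt0.
(* The mesh m_k depends on a and k alone, so E is fixed before any f is given. *)
have [m Hm] := choice (fun k => fence_mesh k.+1 a_decr a_pos a_ratio
  (sqr_ge0 k.+1%:R) (eta0 k)).
pose U k := fence (m k) (eta k).
pose E : set R := `[0, 1] `&` ~` \bigcup_k U k.
have cE : compact E.
  apply: compact_closedI; first exact: segment_compact.
  by apply: open_closedC; apply: bigcup_open => k _; exact: open_fence.
have mU : measurable (\bigcup_k U k).
  by apply: bigcup_measurable => k _; exact: measurable_fence.
exists E; split => //.
- have UE : (lebesgue_measure (`[0%R, 1%R] `&` \bigcup_k U k) <= (2^-1 : R)%:E)%E.
    apply: (@le_trans _ _ (\sum_(k <oo) lebesgue_measure (`[0%R, 1%R] `&` U k))%E).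
      apply: measure_sigma_subadditive.
      + by move=> k; apply: measurableI => //; exact: measurable_fence.
      + exact: measurableI.
      + by rewrite setI_bigcupr.
    have h0 : 0 <= 2^-1 :> R by lra.
    apply: le_trans (epsilon_trick0 xpredT h0).
    apply: lee_nneseries => [k _ _|k _]; first exact: measure_ge0.
    have -> : 2^-1 / (2 ^ k.+1)%:R = 4 * eta k by rewrite /eta; field.
    apply: fence_measure => //.
      by case: (Hm k) => h _; apply: leq_ltn_trans h.
    rewrite /eta ler_pdivrMr ?ltr0n ?expn_gt0// mul1r.
    apply: (@le_trans _ _ 1); first by lra.
    by rewrite ler1n expn_gt0.
  have e : (lebesgue_measure E + lebesgue_measure (`[0%R, 1%R] `&` \bigcup_k U k)
      = (1 : R)%:E)%E.
    have <- : lebesgue_measure (`[0, 1]%classic : set R) = (1 : R)%:E.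
      by rewrite lebesgue_measure_itv /= lte_fin ltr01 oppr0 adde0.
    by rewrite /E -setDE -measureDI.
  rewrite lt0e measure_ge0 andbT; apply/eqP => E0.
  move: UE; rewrite -[X in (X <= _)%E]add0e -{1}E0 e lee_fin; lra.
- move=> [f [L L1 fL] fE].
  have L0 : 0 < L by lra.
  pose b n := f (a n); pose p := f 0.
  have lo n : a n <= L * `|b n - p|.
    have [] := fL (a n) 0; rewrite subr0 gtr0_norm// => h _.
    by rewrite -ler_pdivrMl.
  have up n : `|b n - p| <= L * a n.
    by have [] := fL (a n) 0; rewrite subr0 gtr0_norm.
  have dec n : a n.+1 <= a n by rewrite a_decr.
  have gap n : `|b n - b n.+1| <= L * (a n - a n.+1).
    by have [_] := fL (a n) (a n.+1); rewrite (@ger0_norm _ (a n - _))// subr_ge0.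
  pose K := (Num.truncn L).+1.
  have LK : L < K%:R by exact: truncnS_gt.
  (* From M on, no step of b can jump across p. M is fixed before k, so that the fence can be taken
     finer than the distance from [b M] to p. *)
  have [M HM] := relative_gap_small a_pos a_ratio (sqr_ge0 K%:R) ltr01.
  have scale n k (e : R) : (K <= k)%N ->
      (a n - a n.+1) * k%:R ^+ 2 < e -> (a n - a n.+1) * L ^+ 2 < e.
    move=> Kk; apply: le_lt_trans; apply: ler_wpM2l; first by rewrite subr_ge0.
    rewrite lerXn2r ?nnegrE ?ler0n ?(ltW L0)//.
    by apply: le_trans (ltW LK) _; rewrite ler_nat.
  have bMp : 0 < `|b M - p|.
    by have := lo M; have := a_pos M; nra.
  (* The first entry gives L < k + 1; the second, with k + 1 < m_k, gives 1 / m_k < |b M - p|. *)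
  pose k := maxn K (Num.truncn (`|b M - p|^-1)).+1.
  have Kk : (K <= k.+1)%N by rewrite leqW// leq_maxl.
  have [km fine] := Hm k.
  have m0 : (0 < m k)%N by apply: leq_ltn_trans km.
  have mk : (m k)%:R^-1 < `|b M - p|.
    rewrite -[ltRHS]invrK ltf_pV2 ?posrE ?invr_gt0 ?ltr0n//.
    apply: lt_le_trans (truncnS_gt _) _; rewrite ler_nat.
    apply: leq_trans (ltnW (ltnW km)).
    exact: leq_maxr.
  have small n : (M <= n)%N -> (a n - a n.+1) * L ^+ 2 <= a n.+1.
    by move=> /HM; rewrite mul1r => /(scale n K _ (leqnn K))/ltW.
  have fineL n : a n.+1 <= L / (m k)%:R ->
      (a n - a n.+1) * L ^+ 2 < eta k * a n.+1.
    move=> h; apply: (scale _ k.+1) => //; apply: fine.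
    apply: le_trans h _; rewrite ler_pM2r ?invr_gt0 ?ltr0n//.
    by apply: le_trans (ltW LK) _; rewrite ler_nat.
  have [n bn] : exists n, U k (b n).
    have [pb|bp] := leP p (b M).
      apply: (fence_crossing m0 L0 (eta0 k) a_cvg0 lo up gap small fineL).
      by move: mk; rewrite ger0_norm ?subr_ge0//; lra.
    (* If [b M] lies below p, reflect the line: fences are symmetric about 0. *)
    have NE x y : `|- x - - y| = `|x - y| :> R by rewrite -normrN opprD !opprK.
    have [||||n /fence_opp] := @fence_crossing _ a (fun n => - b n) (- p) L
      (eta k) (m k) M m0 L0 (eta0 k) a_cvg0 _ _ _ small fineL.
    - by move=> n; rewrite NE.
    - by move=> n; rewrite NE.
    - by move=> n; rewrite NE.
    - by move: mk; rewrite ltr0_norm ?subr_lt0//; lra.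
    by exists n.
  have /fE [_ []] : (f @` range a) (b n) by exists (a n) => //; exists n.
  by exists k.
Qed.
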